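(* Let $r\ge 2$ and for $m\in\mathbb{N}$ let $$g_r(m)=\frac1m\sum_{\substack{k=1\\ \gcd(k,m)=1}}^m \big(c_m(k-1)\big)^r.$$ For a prime $p$ put $x_r(p)=(p-1)^r+(-1)^r(p-2)$ and $h_r(p)=\frac{(p-1)^{r-1}+(-1)^r}{p}$, and let $$\alpha_r=\prod_p\left(1+\frac{x_r(p)-p^r}{p^{r+1}}+\frac{p(p-1)h_r(p)-x_r(p)}{p^{r+2}}\right),$$ the product over all primes. Then the average order of $g_r(m)$ is $\alpha_r m^{r-1}$; more precisely, for any $0<\varepsilon<1$, $$\sum_{m\le x} g_r(m)=\frac{\alpha_r}{r}x^r+O(x^{r-1+\varepsilon}).$$
   Context: For $n\in\mathbb{N}$ and $k\in\mathbb{Z}$, $c_n(k)=\sum_{1\le j\le n,\ \gcd(j,n)=1}\exp(2\pi i jk/n)$ is the Ramanujan sum. *)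

(* Defs.v *)
(* MathComp-Analysis, over an arbitrary [R : realType]; complex numbers are [R[i]]. *)
From HB Require Import structures.
From mathcomp Require Export all_boot all_order all_algebra.
From mathcomp Require Export all_classical all_reals all_analysis.
From mathcomp Require Export complex.

Set Implicit Arguments.
Unset Strict Implicit.
Unset Printing Implicit Defensive.

Export Order.TTheory GRing.Theory Num.Theory.
Export numFieldNormedType.Exports.

Local Open Scope ring_scope.
Local Open Scope complex_scope.
Local Open Scope classical_set_scope.

(* Needed for the Landau notations at +oo; the library has no such instance. *)
Canonical pinfty_nbhs_filter_on (R : numFieldType) :=
  FilterType (pinfty_nbhs R) (@filter_filter R _ proper_pinfty_nbhs).

Section Definitions.
Variable R : realType.
Implicit Types (r n m p N : nat) (k : int) (x : R) (z : R[i]).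

Definition cexp z : R[i] :=
  (expR (complex.Re z))%:C * (cos (complex.Im z) +i* sin (complex.Im z)).

Definition ramanujan_sum n k : R[i] :=
  \sum_(1 <= j < n.+1 | coprime j n)
    cexp ((2 * pi)%:C * 'i * j%:R * k%:~R / n%:R).

(* [k - 1] is a difference of integers: at [k = 1] it is [0]. *)
Definition gr r m : R[i] :=
  m%:R^-1 * \sum_(1 <= k < m.+1 | coprime k m)
              ramanujan_sum m (k%:Z - 1) ^+ r.

Definition xr r p : R := (p%:R - 1) ^+ r + (-1) ^+ r * (p%:R - 2).

Definition hr r p : R := ((p%:R - 1) ^+ (r - 1) + (-1) ^+ r) / p%:R.

Definition alpha_factor r p : R :=
  1 + (xr r p - p%:R ^+ r) / p%:R ^+ (r + 1)
    + (p%:R * (p%:R - 1) * hr r p - xr r p) / p%:R ^+ (r + 2).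

Definition alpha_partial r N : R := \prod_(p < N | prime p) alpha_factor r p.

(* Meaningful only when the sequence of partial products converges. *)
Definition alpha r : R := limn (alpha_partial r).

(* [Num.truncn x] is the floor of [x] for [0 <= x], and [0] for [x < 0]. *)
Definition summatory (f : nat -> R[i]) x : R[i] :=
  \sum_(1 <= m < (Num.truncn x).+1) f m.

End Definitions.

(* Naming the [numFieldType] structure lets the norm of [R[i]], and hence the
   Landau notations, be inferred for [R[i]]-valued functions. *)
Definition Cfield (R : realType) : numFieldType := R[i].

(* [f] has average order [a]:
   [f 1 + ... + f n ~ a 1 + ... + a n] as [n] tends to infinity. *)
Definition average_order (R : realType) (f a : nat -> Cfield R) : Prop :=
  (fun n => \sum_(1 <= m < n.+1) f m : Cfield R) ~_\oo
  (fun n => \sum_(1 <= m < n.+1) a m : Cfield R).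

(* Main.v *)
Require Import Defs.
From mathcomp Require Import ring lra zify.

(** [g_r] is multiplicative, by the Chinese remainder theorem applied both to
    the summation variable of the Ramanujan sums and to [k].  Comparing values
    at prime powers, [g_r = f * id^(r-1)] (Dirichlet convolution), where [f] is
    multiplicative and [f p = x_r(p)/p - p^(r-1) = O(p^(r-2))],
    [f (p^2) = (-1)^r p^(r-2)], [f (p^a) = 0] for [a >= 3].  Moreover
    [alpha_r = sum_d f(d) / d^r].
    Summing [sum_(e <= x/d) e^(r-1) = (x/d)^r / r + O((x/d)^(r-1))] against [f],
    the two errors are [x^(r-1) sum_(d <= x) |f d| / d^(r-1)] and
    [x^r sum_(d > x) |f d| / d^r].  By Rankin's trick both are at most
    [x^(r-1+e) S] with [S = sum_d |f d| d^-(r-1+e)], and [S] is finite by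
    comparison of its Euler product with [exp (C sum_n n^(-1-e))].
    The average order needs in addition [alpha_r > 0]: the factors lie in
    [[1/2, 1]] and are [1 - O(p^-2)]. *)

Set Implicit Arguments.
Unset Strict Implicit.
Unset Printing Implicit Defensive.

Local Open Scope ring_scope.
Local Open Scope complex_scope.
Local Open Scope classical_set_scope.

(** * Multiplicative functions and finite Euler products *)

Section Multiplicative.
Variable K : fieldType.
Implicit Types F G : nat -> K.

Definition arith_mult F := F 1%N = 1 /\
  forall m n, (0 < m)%N -> (0 < n)%N -> coprime m n -> F (m * n)%N = F m * F n.

(** Strong induction on [n]: the full power of the least prime factor splits off and is coprime to
    the cofactor. *)
Lemma arith_mult_eq F G : arith_mult F -> arith_mult G ->
  (forall p a, prime p -> F (p ^ a.+1)%N = G (p ^ a.+1)%N) ->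
  forall n, (0 < n)%N -> F n = G n.
Proof.
move=> [F1 FM] [G1 GM] FGp; elim/ltn_ind=> n IHn n0.
have [n1|n1] := leqP n 1.
  have -> : n = 1%N by apply/eqP; rewrite eqn_leq n1.
  by rewrite F1 G1.
have pp := pdiv_prime n1; set p := pdiv n in pp.
have pn : (p %| n)%N := pdiv_dvd n.
rewrite -(partnC p n0) FM ?GM ?part_gt0 ?coprime_partC // p_part.
have lp : (0 < logn p n)%N by rewrite logn_gt0 mem_primes pp n0 pn.
congr (_ * _); first by rewrite -(prednK lp) FGp.
apply: IHn; last exact: part_gt0.
rewrite -{2}(partnC p n0) p_part -[X in (X < _)%N]mul1n ltn_mul2r part_gt0 /=.
by rewrite -(expn0 p) ltn_exp2l // prime_gt1.
Qed.

(** A divisor [x] of the product is recovered from the pair [gcdn x m], [x %/ gcdn x m]. *)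
Lemma perm_divisorsM m n : (0 < m)%N -> (0 < n)%N -> coprime m n ->
  perm_eq (divisors (m * n)) [seq (d * e)%N | d <- divisors m, e <- divisors n].
Proof.
move=> m0 n0 cmn; apply: uniq_perm; first exact: divisors_uniq.
  apply: allpairs_uniq; try exact: divisors_uniq.
  move=> _ _ /allpairsP[[d e] [/= dm en ->]] /allpairsP[[d' e'] [/= dm' en' ->]] /=.
  move: dm en dm' en'; rewrite -!dvdn_divisors // => dm en dm' en' E.
  have gE (x y : nat) : (x %| m -> y %| n -> gcdn m (x * y) = x)%N.
    move=> xm yn; rewrite Gauss_gcdl; first exact/gcdn_idPr.
    exact: coprime_dvdr yn cmn.
  have dd : d = d' by rewrite -(gE d e) // E gE.
  move: E; rewrite -dd => /eqP; rewrite eqn_pmul2l ?(dvdn_gt0 m0 dm) //.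
  by move=> /eqP ->.
move=> x; rewrite -dvdn_divisors ?muln_gt0 ?m0 //; apply/idP/allpairsP.
  move=> xmn; exists (gcdn x m, x %/ gcdn x m)%N => /=.
  have g0 : (0 < gcdn x m)%N by rewrite gcdn_gt0 m0 orbT.
  rewrite -!dvdn_divisors ?dvdn_gcdr //; split=> //.
    have : (x %/ gcdn x m %| (m %/ gcdn x m) * n)%N.
      by rewrite -(dvdn_pmul2l g0) mulnA ![(gcdn x m * _)%N]mulnC !divnK
           ?dvdn_gcdr ?dvdn_gcdl.
    rewrite Gauss_dvdr //; rewrite /coprime -(eqn_pmul2r g0) mul1n.
    by rewrite muln_gcdl !divnK ?dvdn_gcdr ?dvdn_gcdl.
  by rewrite mulnC divnK ?dvdn_gcdl.
move=> [[d e] [/=]]; rewrite -!dvdn_divisors // => dm en ->.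
exact: dvdn_mul.
Qed.

Lemma sum_divisorsM F m n : (0 < m)%N -> (0 < n)%N -> coprime m n ->
  \sum_(d <- divisors (m * n)) F d =
  \sum_(d <- divisors m) \sum_(e <- divisors n) F (d * e)%N.
Proof.
move=> m0 n0 cmn; rewrite (perm_big _ (perm_divisorsM m0 n0 cmn)) /=.
by rewrite big_allpairs_dep.
Qed.

(** Divisors of a product of coprime numbers split uniquely, and their cofactors split along. The
    choice [H d e = F d * G e] gives Dirichlet convolution. *)
Lemma arith_mult_sum_divisors (H : nat -> nat -> K) :
  H 1%N 1%N = 1 ->
  (forall d d' e e', (0 < d)%N -> (0 < d')%N -> (0 < e)%N -> (0 < e')%N ->
     coprime d d' -> coprime e e' ->
     H (d * d')%N (e * e')%N = H d e * H d' e') ->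
  arith_mult (fun m => \sum_(d <- divisors m) H d (m %/ d)%N).
Proof.
move=> H1 HM; split; first by rewrite big_seq1 divn1.
move=> m n m0 n0 cmn; rewrite (sum_divisorsM _ m0 n0 cmn) big_distrlr /=.
apply: eq_big_seq => d; rewrite -dvdn_divisors // => dm.
apply: eq_big_seq => e; rewrite -dvdn_divisors // => en.
have d0 := dvdn_gt0 m0 dm; have e0 := dvdn_gt0 n0 en.
have -> : (m * n %/ (d * e) = (m %/ d) * (n %/ e))%N.
  by rewrite divnMA -[in LHS](divnK dm) -mulnA mulnCA mulKn // muln_divA.
apply: HM => //; try by rewrite divn_gt0 // dvdn_leq.
  exact: coprime_dvdl dm (coprime_dvdr en cmn).
exact: coprime_dvdl (dvdn_div dm) (coprime_dvdr (dvdn_div en) cmn).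
Qed.

Lemma sum_divisors_pexp F p a : prime p ->
  \sum_(d <- divisors (p ^ a)) F d = \sum_(i < a.+1) F (p ^ i)%N.
Proof.
move=> pp; rewrite -(big_map (fun i : 'I_a.+1 => p ^ i)%N xpredT F).
apply: perm_big; apply: uniq_perm; first exact: divisors_uniq.
  rewrite map_inj_uniq ?index_enum_uniq // => i j /eqP.
  by rewrite eqn_exp2l ?prime_gt1 // => /eqP/val_inj.
move=> d; rewrite -dvdn_divisors ?expn_gt0 ?prime_gt0 //.
apply/(dvdn_pfactor _ _ pp)/mapP.
  by move=> [i ia ->]; exists (Ordinal (ia : (i < a.+1)%N)); rewrite ?mem_index_enum.
by move=> [i _ ->]; exists (i : nat) => //; rewrite -ltnS.
Qed.

(** Its divisors are the cube-free integers with all prime factors below [N]: the terms of an Euler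
    product whose factors stop at $p^2$. *)
Definition prime_sq_prod N := (\prod_(p < N | prime p) p ^ 2)%N.

Lemma prime_sq_prod_gt0 N : (0 < prime_sq_prod N)%N.
Proof. by apply: prodn_cond_gt0 => p /prime_gt0 p0; rewrite expn_gt0 p0. Qed.

Lemma dvdn_prime_sq_prod N d : (0 < d < N)%N ->
  (forall p, prime p -> logn p d <= 2)%N -> (d %| prime_sq_prod N)%N.
Proof.
move=> /andP[d0 dN] cf; apply/dvdn_partP => // p.
rewrite mem_primes => /and3P[pp _ pd].
rewrite p_part; apply: (dvdn_trans (dvdn_exp2l p (cf p pp))).
have pN : (p < N)%N by apply: leq_ltn_trans dN; apply: dvdn_leq.
by rewrite /prime_sq_prod (bigD1 (Ordinal pN)) //= dvdn_mulr.
Qed.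

(** Induction on [N]: when [N] is prime, the modulus gains the coprime factor [N ^ 2], and each old
    divisor $d$ yields $d$, $dN$, $dN^2$. *)
Lemma euler_prod F N : arith_mult F ->
  \prod_(p < N | prime p) (1 + F p + F (p ^ 2)%N) =
  \sum_(d <- divisors (prime_sq_prod N)) F d.
Proof.
move=> [F1 FM]; elim: N => [|N IHN].
  by rewrite /prime_sq_prod !big_ord0 big_seq1 F1.
rewrite /prime_sq_prod [LHS]big_mkcond [X in divisors X]big_mkcond !big_ord_recr /=.
rewrite -[in LHS]big_mkcond -[X in (X * _)%N]big_mkcond /= IHN -/(prime_sq_prod N).
case: ifP => pN; last by rewrite mulr1 muln1.
have P0 := prime_sq_prod_gt0 N; have N0 := prime_gt0 pN.
have cPN : coprime (prime_sq_prod N) (N ^ 2).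
  rewrite coprime_pexpr // coprime_sym prime_coprime // /prime_sq_prod.
  rewrite Euclid_dvd_prod // big_orE; apply/negP => /existsP[p /andP[pp]].
  rewrite Euclid_dvdX // => /andP[+ _]; rewrite dvdn_prime2 // => /eqP Np.
  by have := ltn_ord p; rewrite -Np ltnn.
rewrite sum_divisorsM ?expn_gt0 ?N0 // mulr_suml.
apply: eq_big_seq => d; rewrite -dvdn_divisors // => dP.
rewrite sum_divisors_pexp // !big_ord_recr big_ord0 /= add0r expn0 expn1 muln1.
have d0 := dvdn_gt0 P0 dP.
have cd e : (e %| N ^ 2)%N -> coprime d e.
  by move=> eN; apply: coprime_dvdl dP (coprime_dvdr eN cPN).
have NN : (N %| N ^ 2)%N by exact: dvdn_exp.
by rewrite FM ?cd // (FM d (N ^ 2)%N) ?expn_gt0 ?N0 ?cd // !mulrDr mulr1.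
Qed.

Definition mult_extension (u : nat -> nat -> K) n : K :=
  \prod_(p <- primes n) u p (logn p n).

Lemma mult_extension_mult u : arith_mult (mult_extension u).
Proof.
split; first by rewrite /mult_extension big_nil.
move=> m n m0 n0 cmn; rewrite /mult_extension.
have -> : \prod_(p <- primes (m * n)) u p (logn p (m * n)) =
          \prod_(p <- primes m ++ primes n) u p (logn p (m * n)).
  apply: perm_big; apply: uniq_perm; first exact: primes_uniq.
    by rewrite cat_uniq !primes_uniq andbT /= -coprime_has_primes.
  by move=> p; rewrite primesM // mem_cat.
rewrite big_cat /=; congr (_ * _); apply: eq_big_seq => p.
  rewrite mem_primes => /and3P[pp _ pm]; rewrite lognM // [X in (_ + X)%N]logn_coprime ?addn0 //.
  exact: coprime_dvdl pm cmn.
rewrite mem_primes => /and3P[pp _ pm]; rewrite lognM // logn_coprime //.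
by rewrite coprime_sym; apply: coprime_dvdr pm cmn.
Qed.

Lemma mult_extension_pexp u p a : prime p ->
  mult_extension u (p ^ a.+1) = u p a.+1.
Proof. by move=> pp; rewrite /mult_extension primesX // primes_prime // big_seq1 pfactorK. Qed.

End Multiplicative.

(** * Ramanujan sums *)

Section CRT.
Variable K : fieldType.
Implicit Types F G H : nat -> K.

(** A map on the box that is injective modulo [m * n] reaches every residue, by counting. The
    abstract [phi] serves both [a * n + b * m] and [chinese m n]. *)
Lemma sum_ord_mul H m n (phi : nat -> nat -> nat) : (0 < m)%N -> (0 < n)%N ->
  (forall k, H (k %% (m * n))%N = H k) ->
  (forall a b a' b', (a < m)%N -> (a' < m)%N -> (b < n)%N -> (b' < n)%N ->
     phi a b = phi a' b' %[mod m * n] -> a = a' /\ b = b') ->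
  \sum_(k < m * n) H k = \sum_(a < m) \sum_(b < n) H (phi a b).
Proof.
move=> m0 n0 Hper phiI; rewrite pair_bigA /=.
have mn0 : (0 < m * n)%N by rewrite muln_gt0 m0.
pose f (x : 'I_m * 'I_n) : 'I_(m * n) := Ordinal (ltn_pmod (phi x.1 x.2) mn0).
have fI : injective f.
  move=> [a b] [a' b'] /(congr1 val) /= /phiI[] //= aa bb.
  by congr (_, _); apply: val_inj.
rewrite (reindex f) /=; last first.
  by apply: onW_bij; apply: inj_card_bij fI _; rewrite card_prod !card_ord.
by apply: eq_bigr => x _; rewrite Hper.
Qed.

Lemma sum_crt H m n : (0 < m)%N -> (0 < n)%N -> coprime m n ->
  (forall k, H (k %% (m * n))%N = H k) ->
  \sum_(k < m * n) H k = \sum_(a < m) \sum_(b < n) H (a * n + b * m)%N.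
Proof.
move=> m0 n0 cmn Hper.
apply: (@sum_ord_mul _ _ _ (fun a b => a * n + b * m)%N) => // a b a' b' am am' bn bn' /eqP.
rewrite chinese_remainder // => /andP[].
rewrite ![(a * n + _)%N]addnC ![(a' * n + _)%N]addnC !modnMDl => /eqP E1.
rewrite ![(_ * m + _)%N]addnC !modnMDl => /eqP E2.
(* Multiplication by [e] is invertible modulo [d], hence injective on residues below [d]. *)
have modI (x y d e : nat) : (x < d -> y < d -> coprime d e ->
    x * e = y * e %[mod d] -> x = y)%N.
  move=> xd yd de; wlog xy : x y xd yd / (x <= y)%N => [W|].
    by case/orP: (leq_total x y) => h E; [apply: W | apply/esym/W].
  move=> /esym/eqP; rewrite eqn_mod_dvd ?leq_mul2r ?xy ?orbT // -mulnBl.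
  rewrite Gauss_dvdl // => dxy; apply/eqP; rewrite eqn_leq xy /=.
  rewrite -subn_eq0; case: posnP => // p; move: (dvdn_leq p dxy).
  by rewrite leqNgt (leq_ltn_trans (leq_subr _ _) yd).
by split; [apply: modI E1 | apply: modI E2; rewrite // coprime_sym].
Qed.

(** Reindexing by [chinese m n] makes [F] depend on the first residue alone and [G] on the
    second. *)
Lemma sum_crtM F G m n : (0 < m)%N -> (0 < n)%N -> coprime m n ->
  (forall k, F (k %% m)%N = F k) -> (forall k, G (k %% n)%N = G k) ->
  \sum_(k < m * n) F k * G k = (\sum_(k < m) F k) * (\sum_(k < n) G k).
Proof.
move=> m0 n0 cmn Fper Gper.
rewrite (@sum_ord_mul (fun k => F k * G k) _ _ (chinese m n)) //.
- rewrite big_distrlr /=; apply: eq_bigr => a _; apply: eq_bigr => b _.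
  by rewrite -Fper chinese_modl // Fper -Gper chinese_modr // Gper.
- move=> k; rewrite -Fper -Gper modn_dvdm ?dvdn_mulr // modn_dvdm ?dvdn_mull //.
  by rewrite Fper Gper.
move=> a b a' b' am am' bn bn' /eqP.
rewrite chinese_remainder // !chinese_modl // !chinese_modr //.
by rewrite !modn_small // => /andP[/eqP -> /eqP ->].
Qed.

Lemma sum_multiples H d N : (0 < d)%N ->
  \sum_(0 <= j < N.+1 | (d %| j)%N) H j = \sum_(0 <= i < (N %/ d).+1) H (d * i)%N.
Proof.
move=> d0; elim: N => [|N IHN]; first by rewrite big_mkcond div0n !big_nat1 dvdn0 muln0.
rewrite big_mkcond big_nat_recr //= -big_mkcond /= IHN divnS //.
case: ifP => dN; last by rewrite addr0.
rewrite add1n [in RHS]big_nat_recr //= -add1n -[X in (X + _)%N]/(true : nat) -dN.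
by rewrite -divnS // mulnC divnK.
Qed.

Lemma sum_multiples_ord H d n : (0 < d)%N ->
  \sum_(j < d * n | (d %| j)%N) H j = \sum_(i < n) H (d * i)%N.
Proof.
move=> d0; case: n => [|n]; first by rewrite muln0 !big_ord0.
have -> : (d * n.+1 = (d * n + d.-1).+1)%N by rewrite -addnS prednK // mulnS addnC.
rewrite -(big_mkord (fun j => d %| j)%N) sum_multiples // big_mkord.
by rewrite mulnC divnMDl // divn_small ?addn0 // prednK.
Qed.

Lemma sum_expr_unity (y : K) n : y ^+ n = 1 ->
  \sum_(j < n) y ^+ j = if y == 1 then n%:R else 0.
Proof.
move=> yn; case: eqVneq => [->|y1].
  by under eq_bigr do rewrite expr1n; rewrite sumr_const card_ord.
have /eqP := subrX1 y n; rewrite yn subrr eq_sym mulf_eq0 subr_eq0 (negPf y1) /=.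
by move=> /eqP.
Qed.

(** The Ramanujan sum for an arbitrary root of unity [z], which must vary because splitting the
    modulus replaces [z] by its powers. Residues run from [0], not from [1]. *)
Definition ramsum (z : K) m k : K := \sum_(j < m | coprime j m) z ^+ (j * k).

Lemma ramsum_mod z m k : z ^+ m = 1 -> ramsum z m (k %% m) = ramsum z m k.
Proof.
move=> zm; apply: eq_bigr => j _.
by rewrite -(expr_mod _ zm) modnMmr (expr_mod _ zm).
Qed.

(** Put [j = a * n + b * m]: then $z^{jk} = (z^n)^{ak}(z^m)^{bk}$, and [j] is prime to [m * n]
    exactly when [a] is prime to [m] and [b] to [n]. *)
Lemma ramsumM z m n k : (0 < m)%N -> (0 < n)%N -> coprime m n -> z ^+ (m * n) = 1 ->
  ramsum z (m * n) k = ramsum (z ^+ n) m k * ramsum (z ^+ m) n k.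
Proof.
move=> m0 n0 cmn zmn; rewrite /ramsum big_mkcond /=.
rewrite (@sum_crt (fun j => if coprime j (m * n) then z ^+ (j * k) else 0)) //; last first.
  move=> j; rewrite coprime_modl; case: ifP => // _.
  by rewrite -(expr_mod _ zmn) modnMml (expr_mod _ zmn).
rewrite [X in _ = X * _]big_mkcond [X in _ = _ * X]big_mkcond big_distrlr /=.
apply: eq_bigr => a _; apply: eq_bigr => b _.
have -> : coprime (a * n + b * m) (m * n) = coprime a m && coprime b n.
  rewrite coprimeMr -coprime_modl addnC modnMDl coprime_modl coprimeMl.
  rewrite -(coprime_modl _ n) addnC modnMDl coprime_modl coprimeMl cmn.
  by rewrite coprime_sym in cmn; rewrite cmn !andbT.
case: (coprime a m); case: (coprime b n); rewrite ?mul0r ?mulr0 //=.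
rewrite -!exprM -exprD; congr (z ^+ _); ring.
Qed.

(** The residues prime to [p] are all residues minus the multiples of [p]. Both are complete sums,
    over the powers of [z] and of [z ^+ p], so orthogonality evaluates them. *)
Lemma ramsum_pexp z p a k : prime p -> (p ^ a.+1).-primitive_root z ->
  ramsum z (p ^ a.+1) k =
    (p ^ a.+1)%:R *+ (p ^ a.+1 %| k) - (p ^ a)%:R *+ (p ^ a %| k).
Proof.
move=> pp zp; have p0 := prime_gt0 pp; rewrite /ramsum.
have fullE (y : K) n : (n.-primitive_root y)%N ->
    \sum_(j < n) y ^+ (j * k) = n%:R *+ (n %| k).
  move=> yn; under eq_bigr do rewrite mulnC exprM.
  rewrite sum_expr_unity -?exprM; last by rewrite mulnC exprM (prim_expr_order yn) expr1n.
  by rewrite (prim_order_dvd yn); case: eqP.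
rewrite -(fullE z) // -(fullE (z ^+ p) (p ^ a)%N); last first.
  have := dvdn_prim_root zp (dvdn_exp2l p (leqnSn a)).
  by rewrite expnS mulnK // expn_gt0 p0.
have -> : \sum_(j < p ^ a) (z ^+ p) ^+ (j * k) = \sum_(j < p ^ a.+1 | (p %| j)%N) z ^+ (j * k).
  rewrite expnS (@sum_multiples_ord (fun j => z ^+ (j * k))) //.
  by apply: eq_bigr => j _; rewrite -exprM mulnA.
rewrite [in RHS](bigID (fun j : 'I__ => p %| j)%N) /= addrAC subrr add0r.
apply: eq_bigl => j.
by rewrite coprime_pexpr // coprime_sym prime_coprime.
Qed.

(** This is $m\,g_r(m)$ when [z] is the standard root. The index is the $k-1$ of the definition of
    $g_r$, so that no subtraction occurs. *)
Definition ramsum_shift_moment (z : K) r m : K :=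
  \sum_(k < m | coprime k.+1 m) ramsum z m k ^+ r.

(** Each summand is a function of [k] modulo [m] times a function of [k] modulo [n]. *)
Lemma ramsum_shift_momentM z r m n : (0 < m)%N -> (0 < n)%N -> coprime m n ->
  z ^+ (m * n) = 1 ->
  ramsum_shift_moment z r (m * n) =
  ramsum_shift_moment (z ^+ n) r m * ramsum_shift_moment (z ^+ m) r n.
Proof.
move=> m0 n0 cmn zmn; rewrite /ramsum_shift_moment.
pose F k := if coprime k.+1 m then ramsum (z ^+ n) m k ^+ r else 0.
pose G k := if coprime k.+1 n then ramsum (z ^+ m) n k ^+ r else 0.
have cS k d : coprime (k %% d).+1 d = coprime k.+1 d.
  by rewrite -coprime_modl -addn1 modnDml addn1 coprime_modl.
rewrite [X in _ = X * _]big_mkcond [X in _ = _ * X]big_mkcond /= -/F -/G.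
rewrite -(@sum_crtM F G) // => [|k|k]; first last.
- by rewrite /G cS ramsum_mod // -exprM.
- by rewrite /F cS ramsum_mod // -exprM mulnC.
rewrite big_mkcond; apply: eq_bigr => k _; rewrite /F /G coprimeMr.
case: (coprime k.+1 m); case: (coprime k.+1 n); rewrite ?mul0r ?mulr0 //=.
by rewrite ramsumM // exprMn.
Qed.

(** The Ramanujan sum is $p-1$ at $k=0$ and $-1$ at $0<k<p$. The last index $k=p-1$ is excluded
    since $k+1=p$, which leaves $p-2$ terms $(-1)^r$. *)
Lemma ramsum_shift_moment_prime z r p : prime p -> p.-primitive_root z -> (0 < r)%N ->
  ramsum_shift_moment z r p = (p%:R - 1) ^+ r + (-1) ^+ r * (p%:R - 2).
Proof.
move=> pp zp r0; have p1 := prime_gt1 pp; rewrite /ramsum_shift_moment.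
have rE k : ramsum z p k = p%:R *+ (p %| k) - 1.
  by rewrite -[p in LHS]expn1 ramsum_pexp ?expn1 ?expn0 // dvd1n.
under eq_bigr do rewrite rE.
have -> : \sum_(k < p | coprime k.+1 p) (p%:R *+ (p %| k) - 1 : K) ^+ r =
   \sum_(0 <= k < p.-1) (p%:R *+ (p %| k) - 1 : K) ^+ r.
  rewrite -(big_mkord (fun k => coprime k.+1 p)
     (fun k => (p%:R *+ (p %| k) - 1 : K) ^+ r)) big_mkcond.
  rewrite -{1}(prednK (ltnW p1)) big_nat_recr //= prednK ?(ltnW p1) //.
  rewrite /coprime gcdnn gtn_eqF // addr0; apply: eq_big_nat => k /andP[_ kp].
  rewrite ifT //; change (coprime k.+1 p); rewrite coprime_sym prime_coprime //.
  by rewrite gtnNdvd // -(prednK (ltnW p1)) ltnS.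
rewrite big_ltn; last by rewrite -ltnS prednK ?(ltnW p1).
rewrite dvdn0 mulr1n; congr (_ + _).
rewrite (eq_big_nat _ _ (F2 := fun=> (-1) ^+ r)).
  by rewrite sumr_const_nat -subn1 -subnDA -[LHS]mulr_natr natrB.
move=> k /andP[k0 kp]; rewrite gtnNdvd ?mulr0n ?sub0r //.
by apply: leq_trans kp _; apply: leq_pred.
Qed.

(** With $q = p^{a+1}$ the Ramanujan sum vanishes unless $q \mid k$, and then $p \mid k$ makes $k+1$
    prime to $p$. For $k = qi$ with $i<p$ it equals $q(p-1)$ if $i=0$ and $-q$ otherwise. *)
Lemma ramsum_shift_moment_pexp z r p a : prime p ->
  (p ^ a.+2).-primitive_root z -> (0 < r)%N ->
  ramsum_shift_moment z r (p ^ a.+2) =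
  (p ^ a.+1)%:R ^+ r * ((p%:R - 1) ^+ r + (-1) ^+ r * (p%:R - 1)).
Proof.
move=> pp zp r0; have p0 := prime_gt0 pp; have p1 := prime_gt1 pp.
pose q := (p ^ a.+1)%N; have q0 : (0 < q)%N by rewrite expn_gt0 p0.
pose H k : K := (q%:R * (p%:R *+ (p * q %| k) - 1)) ^+ r.
have -> : ramsum_shift_moment z r (p ^ a.+2) = \sum_(k < q * p | (q %| k)%N) H k.
  have rE k := ramsum_pexp k pp zp.
  rewrite /ramsum_shift_moment big_mkcond [in RHS]big_mkcond.
  have qE : (p ^ a.+2 = q * p)%N by rewrite expnSr.
  rewrite qE in rE *; apply: eq_bigr => -[k _] _ /=; rewrite rE -/q.
  case: (boolP (q %| k)%N) => qk.
    rewrite ifT; last first.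
      rewrite -qE coprime_pexpr // coprime_sym prime_coprime //.
      have pk : (p %| k)%N by apply: dvdn_trans qk; rewrite /q expnS dvdn_mulr.
      by rewrite -addn1 dvdn_addr // dvdn1 gtn_eqF.
    rewrite /H mulr1n mulrBr mulr1 natrM [(p * q)%N]mulnC.
    by case: (_ %| k)%N; rewrite ?mulr0n ?mulr0 ?mulr1n.
  have nk : ~~ (q * p %| k)%N.
    by apply: contra qk; apply: dvdn_trans; rewrite dvdn_mulr.
  (* The vanishing sum contributes [0 ^+ r = 0] because [r] is positive. *)
  by rewrite (negPf nk) !mulr0n subr0 expr0n gtn_eqF //; case: ifP.
rewrite sum_multiples_ord // -(big_mkord xpredT (fun i => H (q * i)%N)).
rewrite big_ltn // /H muln0 dvdn0 mulr1n exprMn mulrDr; congr (_ + _).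
rewrite (eq_big_nat _ _ (F2 := fun=> (q%:R : K) ^+ r * (-1) ^+ r)).
  by rewrite sumr_const_nat -[LHS]mulr_natr natrB // mulrA.
move=> k /andP[k0 kp]; rewrite [(q * k)%N]mulnC dvdn_pmul2r // gtnNdvd //.
by rewrite mulr0n sub0r exprMn.
Qed.

End CRT.

(** * Complex roots of unity and the values of $g_r$ at prime powers *)

Section Complex.
Variable R : realType.

Definition cis (t : R) : R[i] := cos t +i* sin t.

Lemma cisD s t : cis (s + t) = cis s * cis t.
Proof.
rewrite /cis sinD cosD; apply/eqP; rewrite eq_complex /=; apply/andP; split; apply/eqP; ring.
Qed.

Lemma cis0 : cis 0 = 1.
Proof. by rewrite /cis cos0 sin0. Qed.

Lemma cisX t n : cis t ^+ n = cis (n%:R * t).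
Proof.
elim: n => [|n IHn]; first by rewrite mul0r cis0.
by rewrite exprS IHn -cisD -natr1 mulrDl mul1r addrC.
Qed.

(** The real part is $1 - 2\sin^2(t/2)$, and $\sin(t/2) > 0$. *)
Lemma cis_neq1 t : 0 < t < 2 * pi -> cis t != 1.
Proof.
move=> /andP[t0 t2]; apply/eqP => -[c1 _].
have s0 : 0 < sin (t / 2).
  by apply: sin_gt0_pi; rewrite divr_gt0 //= ltr_pdivrMr // mulrC.
have s2 : 0 < sin (t / 2) ^+ 2 by rewrite exprn_gt0.
have tE : t = (t / 2) *+ 2 by rewrite -mulr_natr divfK.
by move: c1; rewrite tE cos_mulr2n cos2sin2 => c1; lra.
Qed.

Definition unit_root n : R[i] := cis (2 * pi / n%:R).

Lemma unit_root_exp n k : (0 < k)%N -> unit_root (n * k) ^+ k = unit_root n.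
Proof.
move=> k0; rewrite /unit_root cisX natrM; congr cis.
have kN0 : (k%:R : R) != 0 by rewrite pnatr_eq0 -lt0n.
by rewrite invfM mulrCA; congr (_ * _); rewrite mulrCA divff // mulr1.
Qed.

Lemma cis2pi : cis (2 * pi) = 1.
Proof. by rewrite /cis mulr_natl cos2pi sin2pi. Qed.

Lemma unit_root_prim n : (0 < n)%N -> n.-primitive_root (unit_root n).
Proof.
move=> n0; have nN0 : (n%:R : R) != 0 by rewrite pnatr_eq0 -lt0n.
rewrite /primitive_root_of_unity n0 /=; apply/forallP => i; apply/eqP.
rewrite unity_rootE; case: (eqVneq i.+1 n) => [->|iSn].
  by rewrite /unit_root cisX mulrCA divff // mulr1 cis2pi eqxx.
have iltn : (i.+1 < n)%N by rewrite ltn_neqAle iSn ltn_ord.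
apply/negbTE; rewrite /unit_root cisX; apply: cis_neq1.
have p0 : (0 : R) < 2 * pi by rewrite mulr_gt0 ?pi_gt0.
rewrite mulr_gt0 ?ltr0n ?divr_gt0 ?ltr0n //=.
by rewrite mulrCA gtr_pMr // ltr_pdivrMr ?ltr0n // mul1r ltr_nat.
Qed.

Lemma ramanujan_sumE n (k : nat) : (0 < n)%N ->
  ramanujan_sum R n k%:Z = ramsum (unit_root n) n k.
Proof.
move=> n0; rewrite /ramanujan_sum /ramsum.
have eE j : cexp ((2 * pi)%:C * 'i * j%:R * (k%:Z)%:~R / n%:R) = unit_root n ^+ (j * k).
  have -> : (2 * pi)%:C * 'i * j%:R * (k%:Z)%:~R / n%:R =
            (0 : R) +i* ((j * k)%:R * (2 * pi / n%:R)).
    rewrite -[(k%:Z)%:~R]/(k%:R : R[i]) -!(rmorph_nat (real_complex R)) -fmorphV.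
    rewrite natrM; apply/eqP; rewrite eq_complex /=; apply/andP; split; apply/eqP; ring.
  by rewrite /cexp /= expR0 mul1r cisX.
under eq_bigr do rewrite eE.
rewrite -(big_mkord (fun j => coprime j n) (fun j => unit_root n ^+ (j * k))).
(* The ranges $1..n$ and $0..n-1$ differ by the terms $j=n$ and $j=0$, which agree: the same gcd
   with $n$, and both powers of the root are $1$. *)
rewrite big_mkcond big_nat_recr //= [in RHS]big_mkcond [in RHS]big_ltn //= addrC.
rewrite mul0n expr0 exprM (prim_expr_order (unit_root_prim n0)) expr1n.
by rewrite /coprime gcdnn gcd0n.
Qed.

Lemma grE r m : (0 < m)%N ->
  gr R r m = m%:R^-1 * ramsum_shift_moment (unit_root m) r m.
Proof.
move=> m0; rewrite /gr /ramsum_shift_moment; congr (_ * _).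
rewrite big_add1 /= big_mkord; apply: eq_bigr => k _.
by rewrite -ramanujan_sumE // -addn1 PoszD addrK.
Qed.

(** The powers of the standard root produced by the splitting are again standard:
    [unit_root (m * n) ^+ n] is [unit_root m]. *)
Lemma gr_mult r : arith_mult (gr R r).
Proof.
split.
  rewrite grE // invr1 mul1r /ramsum_shift_moment big_mkcond big_ord1 /=.
  by rewrite /ramsum big_mkcond big_ord1 /= mul0n expr0 expr1n.
move=> m n m0 n0 cmn; rewrite !grE ?muln_gt0 ?m0 //.
rewrite ramsum_shift_momentM //; last first.
  by apply: prim_expr_order; apply: unit_root_prim; rewrite muln_gt0 m0.
rewrite unit_root_exp // [X in unit_root X ^+ m]mulnC unit_root_exp //.
by rewrite natrM invfM mulrACA.
Qed.

Lemma gr_prime r p : prime p -> (0 < r)%N -> gr R r p = (xr R r p / p%:R)%:C.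
Proof.
move=> pp r0; have p0 := prime_gt0 pp.
rewrite grE // ramsum_shift_moment_prime ?unit_root_prim // /xr.
by rewrite mulrC fmorph_div !(rmorphD, rmorphM, rmorphXn, rmorphN, rmorph_nat, rmorph1).
Qed.

Lemma gr_pexp r p a : prime p -> (0 < r)%N ->
  gr R r (p ^ a.+2) = ((p ^ a.+1)%:R ^+ r * ((p%:R - 1) ^+ r + (-1) ^+ r * (p%:R - 1)) /
   (p ^ a.+2)%:R)%:C.
Proof.
move=> pp r0; have p0 : (0 < p ^ a.+2)%N by rewrite expn_gt0 prime_gt0.
rewrite grE // ramsum_shift_moment_pexp ?unit_root_prim //.
by rewrite mulrC fmorph_div !(rmorphD, rmorphM, rmorphXn, rmorphN, rmorph_nat, rmorph1).
Qed.

End Complex.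

(** * Power sums *)

Section PowerBounds.
Variable R : realType.

(** Factor out [b - a]: each of the [n.+1] terms of the cofactor is at most [b ^+ n]; for the next
    lemma, at least [a ^+ n]. *)
Lemma exprB_le (a b : R) n : 0 <= a <= b ->
  b ^+ n.+1 - a ^+ n.+1 <= n.+1%:R * b ^+ n * (b - a).
Proof.
move=> /andP[a0 ab]; have b0 := le_trans a0 ab.
rewrite subrXX mulrC ler_wpM2r ?subr_ge0 //.
apply: (@le_trans _ _ (\sum_(i < n.+1) b ^+ n)).
  apply: ler_sum => i _ /=.
  rewrite -[in leRHS](subnK (leq_ord i)) exprD ler_wpM2l ?exprn_ge0 //.
  by rewrite lerXn2r ?nnegrE.
by rewrite sumr_const card_ord -[leLHS]mulr_natl.
Qed.

Lemma exprB_ge (a b : R) n : 0 <= a <= b ->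
  n.+1%:R * a ^+ n * (b - a) <= b ^+ n.+1 - a ^+ n.+1.
Proof.
move=> /andP[a0 ab]; have b0 := le_trans a0 ab.
rewrite subrXX [leRHS]mulrC ler_wpM2r ?subr_ge0 //.
apply: (@le_trans _ _ (\sum_(i < n.+1) a ^+ n)).
  by rewrite sumr_const card_ord -[leRHS]mulr_natl.
apply: ler_sum => i _ /=.
rewrite -[in leLHS](subnK (leq_ord i)) exprD ler_wpM2r ?exprn_ge0 //.
by rewrite lerXn2r ?nnegrE.
Qed.

(** Discrete comparison with $\int_0^N t^s\,dt$: the increment of $N^{s+1}$ is at most
    $(s+1)(N+1)^s$. *)
Lemma sum_expr_ge (s N : nat) :
  (N%:R ^+ s.+1) / s.+1%:R <= \sum_(1 <= e < N.+1) (e%:R : R) ^+ s.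
Proof.
elim: N => [|N IHN]; first by rewrite big_nil expr0n mul0r.
rewrite big_nat_recr //=.
have := @exprB_le N%:R N.+1%:R s; rewrite ler0n ler_nat leqnSn /= => /(_ isT).
rewrite -natr1 (addrC N%:R) addrK mulr1 => h.
have s0 : (0 : R) < s.+1%:R by rewrite ltr0n.
move: IHN; rewrite !ler_pdivrMr // mulrDl => IHN.
by rewrite [_ ^+ s * _]mulrC; lra.
Qed.

Lemma sum_expr_le (s N : nat) :
  \sum_(1 <= e < N.+1) (e%:R : R) ^+ s <= (N%:R ^+ s.+1) / s.+1%:R + N%:R ^+ s.
Proof.
have s0 : (0 : R) < s.+1%:R by rewrite ltr0n.
case: N => [|N]; first by rewrite big_nil expr0n mul0r add0r exprn_ge0.
(* The last term is exactly the allowed error; the remaining ones stay below the integral. *)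
rewrite big_nat_recr //= lerD2r.
elim: N => [|N IHN]; first by rewrite big_nil divr_ge0 // exprn_ge0.
rewrite big_nat_recr //=; move: IHN; rewrite !ler_pdivlMr // mulrDl => IHN.
have := @exprB_ge N.+1%:R N.+2%:R s; rewrite ler0n ler_nat leqnSn /= => /(_ isT).
rewrite -[N.+2%:R]natr1 (addrC N.+1%:R) addrK mulr1 => h.
by rewrite [_ ^+ s * _]mulrC; lra.
Qed.

(** From above, [sum_expr_le] gives an excess of at most $N^s$. From below, replacing $N$ by $y$ in
    the main term costs at most $y^s(y-N) \le y^s$. *)
Lemma sum_expr_approx (s N : nat) (y : R) : N%:R <= y < N.+1%:R ->
  `|\sum_(1 <= e < N.+1) (e%:R : R) ^+ s - y ^+ s.+1 / s.+1%:R| <= y ^+ s.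
Proof.
move=> /andP[Ny yN]; have s0 : (0 : R) < s.+1%:R by rewrite ltr0n.
have N0 : (0 : R) <= N%:R by [].
have y0 := le_trans N0 Ny.
have h1 := sum_expr_ge s N; have h2 := sum_expr_le s N.
have h3 : (N%:R : R) ^+ s <= y ^+ s by rewrite lerXn2r ?nnegrE.
have h4 : (N%:R : R) ^+ s.+1 / s.+1%:R <= y ^+ s.+1 / s.+1%:R.
  by rewrite ler_pM2r ?invr_gt0 // lerXn2r ?nnegrE.
have h5 : y ^+ s.+1 / s.+1%:R - N%:R ^+ s.+1 / s.+1%:R <= y ^+ s.
  rewrite -mulrBl ler_pdivrMr //.
  have := @exprB_le N%:R y s; rewrite N0 Ny => /(_ isT) /le_trans; apply.
  rewrite -mulrA mulrC ler_pM2r // ler_piMr ?exprn_ge0 //.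
  by move: yN; rewrite -natr1 => yN; lra.
move: h1 h2 h3 h4 h5; move: (bigop _ _ _) (N%:R ^+ s.+1 / _) (y ^+ s.+1 / _) (N%:R ^+ s) (y ^+ s).
by move=> A B C D E *; rewrite ler_norml; apply/andP; split; lra.
Qed.

(** Mean value inequality for $t^{-e}$ on $[n+1,n+2]$. With $h = 1/(n+2)$ it reads $1+eh \le
    (1-h)^{-e}$, which follows from $\ln(1-h) \le -h$ and $1+t \le \exp t$. *)
Lemma powRN1D_le (e : R) n : 0 < e ->
  n.+2%:R `^ (- 1 - e) <= (n.+1%:R `^ (- e) - n.+2%:R `^ (- e)) / e.
Proof.
move=> e0; rewrite ler_pdivlMr //.
have n1 : (0 : R) < n.+1%:R by rewrite ltr0n.
have n2 : (0 : R) < n.+2%:R by rewrite ltr0n.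
have n2N0 : (n.+2%:R : R) != 0 by rewrite gt_eqF.
rewrite powRD ?n2N0 ?implybT // powR_inv1 ?(ltW n2) //.
have -> : (n.+1%:R : R) `^ (- e) = n.+2%:R `^ (- e) * (n.+1%:R / n.+2%:R) `^ (- e).
  by rewrite -powRM ?divr_ge0 // mulrC divfK.
rewrite -[X in _ <= _ - X]mulr1 -mulrBr [_^-1 * _]mulrC -mulrA.
rewrite ler_wpM2l ?powR_ge0 //.
rewrite /powR gt_eqF ?divr_gt0 //.
have lnle : ln (n.+1%:R / n.+2%:R : R) <= - n.+2%:R^-1.
  have -> : (n.+1%:R / n.+2%:R : R) = 1 + - n.+2%:R^-1.
    by rewrite -[n.+1%:R](addrK 1) natr1 mulrBl divff // mul1r.
  rewrite le_ln1Dx // ltrN2 invf_lt1 // ltr1n //.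
have := expR_ge1Dx (- e * ln (n.+1%:R / n.+2%:R)).
have : e * n.+2%:R^-1 <= - e * ln (n.+1%:R / n.+2%:R).
  by rewrite mulNr -mulrN ler_pM2l // lerNr.
rewrite [e * _^-1]mulrC; move: (n.+2%:R^-1 * e) (- e * _) (expR _) => A B C; lra.
Qed.

Lemma sum_powRN1D_le (e : R) N : 0 < e ->
  \sum_(1 <= n < N) (n%:R : R) `^ (- 1 - e) <= 1 + e^-1.
Proof.
move=> e0; have ei : 0 < e^-1 by rewrite invr_gt0.
have [N1|N1] := leqP N 1; first by rewrite big_geq //; lra.
(* Keeping the telescoped remainder makes the bound inductive; the leading [1] is the term $n=1$. *)
suff H M : \sum_(1 <= n < M.+2) (n%:R : R) `^ (- 1 - e) <= 1 + e^-1 - M.+1%:R `^ (- e) / e.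
  case: N N1 => [|[|N]] // _; apply: le_trans (H N) _.
  by rewrite gerBl divr_ge0 ?powR_ge0 ?(ltW e0).
elim: M => [|M IHM]; first by rewrite big_nat1 !powR1 mul1r; lra.
rewrite big_nat_recr //=; have := powRN1D_le M e0; rewrite mulrBl; lra.
Qed.

End PowerBounds.

(** * The convolution identity *)

Section Convolution.
Variables (R : realType) (s : nat).

(* [f] of the header for [r = s.+2]; the value at [a = 0] is never used. *)
Definition gr_quot_pexp (p a : nat) : R :=
  match a with
  | 1 => xr R s.+2 p / p%:R - p%:R ^+ s.+1
  | 2 => (-1) ^+ s.+2 * p%:R ^+ s
  | _ => 0
  end.

Definition gr_quot : nat -> R := mult_extension gr_quot_pexp.

Lemma gr_quot_mult : arith_mult gr_quot.
Proof. exact: mult_extension_mult. Qed.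

Lemma gr_quot_pexpE p a : prime p -> gr_quot (p ^ a.+1) = gr_quot_pexp p a.+1.
Proof. exact: mult_extension_pexp. Qed.

Lemma gr_quot_primeE p : prime p -> gr_quot p = xr R s.+2 p / p%:R - p%:R ^+ s.+1.
Proof. by move=> pp; have := gr_quot_pexpE 0 pp; rewrite expn1. Qed.

Lemma gr_quot_sqE p : prime p -> gr_quot (p ^ 2) = (-1) ^+ s.+2 * p%:R ^+ s.
Proof. exact: gr_quot_pexpE. Qed.

Lemma gr_quot_cube_free d : gr_quot d != 0 -> forall p, prime p -> (logn p d <= 2)%N.
Proof.
move=> dN0 p pp; have [pd|] := boolP (p \in primes d); last first.
  by rewrite -logn_gt0 -eqn0Ngt => /eqP ->.
move: dN0; rewrite /gr_quot /mult_extension prodf_seq_neq0 => /allP /(_ p pd) /=.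
by case: (logn p d) => [|[|[|]]] //=; rewrite eqxx.
Qed.

(** The convolution $f * \mathrm{id}^{r-1}$, taken in [R] so that the estimates can be made with
    real inequalities; [gr_realE] identifies it with $g_r$. *)
Definition gr_real m : R := \sum_(d <- divisors m) gr_quot d * (m %/ d)%:R ^+ s.+1.

Lemma gr_real_mult : arith_mult gr_real.
Proof.
apply: (arith_mult_sum_divisors (H := fun d e => gr_quot d * e%:R ^+ s.+1)).
  by rewrite gr_quot_mult.1 expr1n mulr1.
move=> d d' e e' d0 d'0 e0 e'0 cd _.
by rewrite gr_quot_mult.2 // natrM exprMn mulrACA.
Qed.

Lemma gr_real_prime p : prime p -> gr_real p = xr R s.+2 p / p%:R.
Proof.
move=> pp; have p0 := prime_gt0 pp.
rewrite /gr_real -{1}[p]expn1 sum_divisors_pexp // !big_ord_recl big_ord0 /= addr0.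
rewrite /bump /= expn0 addn0 expn1 divnn p0 divn1 gr_quot_mult.1 gr_quot_primeE //.
by rewrite mul1r expr1n mulr1 addrC subrK.
Qed.

Lemma gr_real_pexp p a : prime p ->
  gr_real (p ^ a.+2) = (p ^ a.+1)%:R ^+ s.+2 *
    ((p%:R - 1) ^+ s.+2 + (-1) ^+ s.+2 * (p%:R - 1)) / (p ^ a.+2)%:R.
Proof.
move=> pp; have p0 := prime_gt0 pp; have pN0 : (p%:R : R) != 0 by rewrite pnatr_eq0 -lt0n.
rewrite /gr_real sum_divisors_pexp // !big_ord_recl /= big1 ?addr0; last first.
  by move=> i _; rewrite gr_quot_pexpE //= mul0r.
rewrite /bump /= expn0 expn1 gr_quot_mult.1 divn1 gr_quot_primeE // gr_quot_sqE //.
have -> : (p ^ a.+2 %/ p = p ^ a.+1)%N by rewrite expnS mulKn.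
have -> : (p ^ a.+2 %/ p ^ 2 = p ^ a)%N by rewrite -(addn2 a) expnD mulnK // expn_gt0 p0.
rewrite /xr !natrX.
(* Only the divisors $1$, $p$, $p^2$ contribute. Their symbolic powers are reduced to the atoms
   $p^{a+2}$, $p^{a(s+1)}$ and $p^s$, which leaves a rational identity. *)
have E1 : (p%:R ^+ a.+2 : R) ^+ s.+1 = p%:R ^+ a ^+ s.+1 * p%:R ^+ s.+1 * p%:R ^+ s.+1.
  by rewrite -!exprM -!exprD; congr (_ ^+ _); lia.
have E2 : (p%:R ^+ a.+1 : R) ^+ s.+1 = p%:R ^+ a ^+ s.+1 * p%:R ^+ s.+1.
  by rewrite -!exprM -!exprD; congr (_ ^+ _); lia.
have E3 : (p%:R ^+ a.+1 : R) ^+ s.+2 = p%:R ^+ a ^+ s.+1 * p%:R ^+ s * p%:R ^+ a.+2.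
  by rewrite -!exprM -!exprD; congr (_ ^+ _); lia.
rewrite E1 E2 E3 [p%:R ^+ s.+1]exprS.
have aN0 : (p%:R ^+ a.+2 : R) != 0 by rewrite expf_neq0.
move: (p%:R ^+ a.+2 : R) (p%:R ^+ a ^+ s.+1 : R) (p%:R ^+ s : R) ((-1) ^+ s.+2 : R)
  ((p%:R - 1 : R) ^+ s.+2) aN0 => A Y P e x AN0.
by field; rewrite AN0 pN0.
Qed.

Lemma gr_realE m : (0 < m)%N -> gr R s.+2 m = (gr_real m)%:C%C.
Proof.
apply: (arith_mult_eq (G := fun m => (gr_real m)%:C%C) (gr_mult R s.+2)).
  split; first by rewrite gr_real_mult.1 rmorph1.
  by move=> a b a0 b0 cab; rewrite gr_real_mult.2 // rmorphM.
move=> p [|a] pp; first by rewrite expn1 gr_prime // gr_real_prime.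
by rewrite gr_pexp // gr_real_pexp.
Qed.

Lemma sum_gr_real N :
  \sum_(1 <= m < N.+1) gr_real m =
  \sum_(1 <= d < N.+1) gr_quot d * \sum_(1 <= e < (N %/ d).+1) (e%:R : R) ^+ s.+1.
Proof.
have E m : (1 <= m < N.+1)%N -> gr_real m =
    \sum_(1 <= d < N.+1) (if (d %| m)%N then gr_quot d * (m %/ d)%:R ^+ s.+1 else 0).
  move=> /andP[m1 mN]; rewrite /gr_real -big_mkcond -[in RHS]big_filter; apply: perm_big.
  apply: uniq_perm; rewrite ?divisors_uniq ?filter_uniq ?iota_uniq // => d.
  rewrite -dvdn_divisors // mem_filter mem_index_iota.
  case: (boolP (d %| m)%N) => //= dm; rewrite (dvdn_gt0 m1 dm) /= ltnS.
  by rewrite (leq_trans (dvdn_leq m1 dm)).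
rewrite (eq_big_nat _ _ E) exchange_big /=; apply: eq_big_nat => d /andP[d1 _].
rewrite mulr_sumr.
(* The value [0] at [m = 0] allows summation over multiples of [d] starting from [0]. *)
pose H m := if m == 0%N then 0 else gr_quot d * (m %/ d)%:R ^+ s.+1.
transitivity (\sum_(0 <= m < N.+1 | (d %| m)%N) H m).
  rewrite [in RHS]big_mkcond [in RHS]big_ltn //= dvdn0 add0r.
  apply: eq_big_nat => m /andP[m1 _]; rewrite /H gtn_eqF //.
rewrite sum_multiples // big_ltn // muln0 add0r; apply: eq_big_nat => e /andP[e1 _].
by rewrite /H muln_eq0 !gtn_eqF //= mulKn.
Qed.

End Convolution.

(** * Rankin's trick *)

Section Rankin.
Variables (R : realType) (s : nat).
Local Notation f := (gr_quot R s).

(** Over the denominator $p$, the difference $p^{s+2}-(p-1)^{s+2}$ is at most $(s+2)p^{s+1}$, and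
    $|p-2|$ adds at most one more $p^{s+1}$. *)
Lemma gr_quot_prime_le p : prime p -> `|f p| <= s.+3%:R * p%:R ^+ s.
Proof.
move=> pp; have p1 : (1 : R) < p%:R by rewrite ltr1n prime_gt1.
have p0 : (0 : R) < p%:R by lra.
have pN0 : (p%:R : R) != 0 by rewrite gt_eqF.
rewrite gr_quot_primeE // /xr.
have -> : ((p%:R - 1) ^+ s.+2 + (-1) ^+ s.+2 * (p%:R - 2)) / p%:R - p%:R ^+ s.+1 =
    (((p%:R - 1) ^+ s.+2 - p%:R ^+ s.+2) + (-1) ^+ s.+2 * (p%:R - 2)) / p%:R :> R.
  by rewrite [in RHS]addrAC [in RHS]mulrBl [p%:R ^+ s.+2]exprSr mulfK.
rewrite normrM [X in _ * X]gtr0_norm ?invr_gt0 // ler_pdivrMr //.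
apply: le_trans (ler_normD _ _) _; rewrite normrM normrX normrN1 expr1n mul1r.
rewrite distrC [`|_ ^+ _ - _|]ger0_norm; last first.
  by rewrite subr_ge0 lerXn2r ?nnegrE ?(ltW p0) //; lra.
have := @exprB_le R (p%:R - 1) p%:R s.+1; rewrite subr_ge0 (ltW p1) gerBl ler01 => /(_ isT).
rewrite opprB addrCA subrr addr0 mulr1 => h1.
have h2 : `|p%:R - 2 : R| <= p%:R ^+ s.+1.
  apply: (@le_trans _ _ (p%:R)); last by rewrite exprS ler_peMr ?(ltW p0) ?exprn_ege1 ?(ltW p1).
  by rewrite ler_norml; apply/andP; split; lra.
rewrite -mulrA -exprSr -[s.+3%:R]natr1 mulrDl mul1r; exact: lerD.
Qed.

Local Notation F := (fun d : nat => f d / d%:R ^+ s.+2).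

Lemma gr_quot_div_mult : arith_mult F.
Proof.
split; first by rewrite /= (gr_quot_mult R s).1 expr1n divr1.
move=> m n m0 n0 cmn; rewrite /= (gr_quot_mult R s).2 // natrM exprMn.
by rewrite invfM mulrACA.
Qed.

(** Here $p(p-1)h_r(p) - x_r(p) = (-1)^r$, so the last summand of the factor is $(-1)^r/p^{r+2} =
    f(p^2)/p^{2r}$. *)
Lemma alpha_factorE p : prime p -> alpha_factor R s.+2 p = 1 + F p + F (p ^ 2)%N.
Proof.
move=> pp; have p0 := prime_gt0 pp.
have pN0 : (p%:R : R) != 0 by rewrite pnatr_eq0 -lt0n.
rewrite /alpha_factor gr_quot_primeE // gr_quot_sqE // /hr /xr subn1 /= natrX.
rewrite addn1 addn2.
have -> : (p%:R ^+ 2) ^+ s.+2 = p%:R ^+ s * p%:R ^+ s.+4 :> R.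
  by rewrite -exprM -exprD; congr (_ ^+ _); lia.
rewrite ![p%:R ^+ s.+4]exprS ![p%:R ^+ s.+3]exprS ![p%:R ^+ s.+2]exprS ![p%:R ^+ s.+1]exprS.
rewrite ![(p%:R - 1) ^+ s.+2]exprS.
have PN0 : (p%:R ^+ s : R) != 0 by rewrite expf_neq0.
move: (p%:R : R) (p%:R ^+ s : R) ((-1) ^+ s.+2 : R) ((p%:R - 1 : R) ^+ s.+1) pN0 PN0.
move=> q P c x qN PN.
by field; rewrite qN PN.
Qed.

Lemma alpha_partialE N :
  alpha_partial R s.+2 N = \sum_(d <- divisors (prime_sq_prod N)) F d.
Proof.
rewrite -euler_prod; last exact: gr_quot_div_mult.
by apply: eq_bigr => p pp; rewrite alpha_factorE.
Qed.

Variable e : R.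
Hypothesis e0 : 0 < e.

Definition rankin_term d : R := `|f d| * d%:R `^ (- (s.+1%:R + e)).

Lemma rankin_term_ge0 d : 0 <= rankin_term d.
Proof. by rewrite mulr_ge0 ?powR_ge0. Qed.

Lemma rankin_term_mult : arith_mult rankin_term.
Proof.
split; first by rewrite /rankin_term (gr_quot_mult R s).1 normr1 powR1 mulr1.
move=> m n m0 n0 cmn; rewrite /rankin_term (gr_quot_mult R s).2 // normrM natrM.
by rewrite powRM // mulrACA.
Qed.

Lemma expr_mul_powRN p : (0 < p)%N ->
  (p%:R : R) ^+ s * p%:R `^ (- (s.+1%:R + e)) = p%:R `^ (- 1 - e).
Proof.
move=> p0; rewrite -powR_mulrn // -powRD ?pnatr_eq0 -?lt0n ?p0 ?implybT //.
by congr (_ `^ _); rewrite -natr1; ring.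
Qed.

Lemma rankin_term_prime_le p : prime p ->
  rankin_term p + rankin_term (p ^ 2) <= s.+4%:R * p%:R `^ (- 1 - e).
Proof.
move=> pp; have p0 := prime_gt0 pp; rewrite -[s.+4%:R]natr1 mulrDl mul1r.
rewrite -expr_mul_powRN //; apply: lerD.
  by rewrite mulrA ler_wpM2r ?powR_ge0 // gr_quot_prime_le.
(* The square is bounded crudely, with $p$ in place of $p^2$ under the negative exponent; this
   accounts for one unit of [s.+4]. *)
rewrite /rankin_term gr_quot_sqE // normrM normrX normrN1 expr1n mul1r.
rewrite ger0_norm ?exprn_ge0 // ler_wpM2l ?exprn_ge0 //.
rewrite !powRN lef_pV2 ?posrE ?powR_gt0 ?ltr0n ?expn_gt0 ?p0 //.
apply: ge0_ler_powR; rewrite ?nnegrE ?addr_ge0 ?(ltW e0) //.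
by rewrite ler_nat -{1}[p]expn1 leq_pexp2l.
Qed.

Lemma sum_prime_powRN_le N :
  \sum_(p < N | prime p) (p%:R : R) `^ (- 1 - e) <= 1 + e^-1.
Proof.
apply: le_trans (sum_powRN1D_le N e0).
rewrite -(big_mkord (fun p => prime p) (fun p => (p%:R : R) `^ (- 1 - e))).
case: N => [|N]; first by rewrite !big_geq.
rewrite big_mkcond big_ltn //= add0r; apply: ler_sum => p _.
by case: ifP => // _; apply: powR_ge0.
Qed.

(** The factor [1 + e^-1] bounds $\sum_n n^{-1-e}$, and [s.+4] is the constant of
    [rankin_term_prime_le]. *)
Definition rankin_bound : R := expR (s.+4%:R * (1 + e^-1)).

Lemma sum_rankin_term_le N :
  \sum_(d <- divisors (prime_sq_prod N)) rankin_term d <= rankin_bound.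
Proof.
rewrite -euler_prod; last exact: rankin_term_mult.
apply: (@le_trans _ _ (\prod_(p < N | prime p) expR (s.+4%:R * p%:R `^ (- 1 - e)))).
  apply: ler_prod => p pp; rewrite !addr_ge0 ?rankin_term_ge0 //=.
  apply: le_trans (expR_ge1Dx _); rewrite -addrA lerD2l.
  exact: rankin_term_prime_le.
rewrite -expR_sum ler_expR -mulr_sumr ler_wpM2l //.
exact: sum_prime_powRN_le.
Qed.

(** Any $d<N$ with $f(d) \ne 0$ is cube-free with prime factors below $N$, hence a divisor of
    [prime_sq_prod N]; the other divisors contribute nonnegative terms. *)
Lemma sum_rankin_term_nat_le N : \sum_(1 <= d < N) rankin_term d <= rankin_bound.
Proof.
apply: le_trans (sum_rankin_term_le N).
rewrite (bigID (fun d => d \in divisors (prime_sq_prod N))) /= [X in _ + X]big_nat_cond.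
rewrite [X in _ + X]big1 ?addr0; last first.
  move=> d /andP[/andP[d0 dN]]; rewrite -dvdn_divisors ?prime_sq_prod_gt0 // => dP.
  have [fd|fd] := eqVneq (f d) 0; first by rewrite /rankin_term fd normr0 mul0r.
  move: dP; rewrite dvdn_prime_sq_prod ?d0 //; exact: gr_quot_cube_free fd.
rewrite -big_filter [leRHS](bigID (fun d => d \in index_iota 1 N)) /=.
rewrite -[X in _ <= X + _]big_filter.
have -> : \sum_(i <- [seq i <- index_iota 1 N | i \in divisors (prime_sq_prod N)]) rankin_term i =
   \sum_(i <- [seq i <- divisors (prime_sq_prod N) | i \in index_iota 1 N]) rankin_term i.
  apply: perm_big; apply: uniq_perm; rewrite ?filter_uniq ?iota_uniq ?divisors_uniq //.
  by move=> d; rewrite !mem_filter andbC.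
rewrite lerDl; apply: sumr_ge0 => d _; exact: rankin_term_ge0.
Qed.

End Rankin.

(** * The constant [alpha] *)

Section Alpha.
Variables (R : realType) (s : nat).
Local Notation f := (gr_quot R s).
Local Notation F := (fun d : nat => f d / d%:R ^+ s.+2).

(** Rankin's splitting: the factor $d^{e-1}$ is small on the tail when $e<1$. *)
Lemma norm_gr_quot_div (e : R) d : (0 < d)%N ->
  `|F d| = rankin_term s e d * d%:R `^ (e - 1).
Proof.
move=> d0; rewrite normrM normfV [`|_ ^+ _|]ger0_norm ?exprn_ge0 // /rankin_term.
rewrite -powR_mulrn // -powRN -mulrA -powRD ?pnatr_eq0 -?lt0n ?d0 ?implybT //.
by congr (_ * _ `^ _); rewrite -[s.+2%:R]natr1; ring.
Qed.

Lemma alpha_factorB1 p : prime p -> alpha_factor R s.+2 p - 1 =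
  (xr R s.+2 p - p%:R ^+ s.+2 + (-1) ^+ s.+2 / p%:R) / p%:R ^+ s.+3.
Proof.
move=> pp; have p0 := prime_gt0 pp.
have pN0 : (p%:R : R) != 0 by rewrite pnatr_eq0 -lt0n.
rewrite alpha_factorE // gr_quot_primeE // gr_quot_sqE // natrX.
have -> : (p%:R ^+ 2) ^+ s.+2 = p%:R ^+ s * p%:R ^+ s.+4 :> R.
  by rewrite -exprM -exprD; congr (_ ^+ _); lia.
rewrite ![p%:R ^+ s.+4]exprS ![p%:R ^+ s.+3]exprS ![p%:R ^+ s.+2]exprS ![p%:R ^+ s.+1]exprS.
have PN0 : (p%:R ^+ s : R) != 0 by rewrite expf_neq0.
move: (p%:R : R) (p%:R ^+ s : R) ((-1) ^+ s.+2 : R) (xr _ _ _) pN0 PN0.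
move=> q P c x qN PN.
by field; rewrite qN PN.
Qed.

(** Below: the factor is $1-1/p$ plus $(x_r+(-1)^r/p)/p^{r+1}$, which is nonnegative because $x_r
    \ge 1$. Above: $(p-1)^r \le p^r-p^{r-1}$ absorbs the remaining terms, which are less than $p \le
    p^{r-1}$. *)
Lemma alpha_factor_itv p : prime p -> 2^-1 <= alpha_factor R s.+2 p <= 1.
Proof.
move=> pp; have p2 : (2 : R) <= p%:R by rewrite ler_nat prime_gt1.
have p0 : (0 : R) < p%:R by lra.
have c1 : `|(-1) ^+ s.+2 : R| <= 1 by rewrite normrX normrN1 expr1n.
have pi0 : 0 < (p%:R : R)^-1 by rewrite invr_gt0.
have pi2 : (p%:R : R)^-1 <= 2^-1 by rewrite lef_pV2 ?posrE.
have /ler_normlP[cl cu] := c1.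
have ci : `|(-1) ^+ s.+2 / p%:R : R| <= 2^-1.
  by rewrite normrM -[leRHS]mul1r ler_pM // gtr0_norm.
have /ler_normlP[dl du] := ci.
have P0 : 0 < (p%:R : R) ^+ s.+2 by rewrite exprn_gt0.
have E : (p%:R : R) ^+ s.+2 / p%:R ^+ s.+3 = p%:R^-1.
  by rewrite [p%:R ^+ s.+3]exprS invfM mulrCA divff ?mulr1 // gt_eqF.
apply/andP; split.
  have x1 : 1 <= xr R s.+2 p.
    have h : (p%:R - 1) ^+ 2 <= (p%:R - 1) ^+ s.+2 :> R by rewrite ler_weXn2l //; lra.
    rewrite /xr; move: ((p%:R - 1) ^+ s.+2) ((-1) ^+ s.+2) h cl cu => X c; rewrite expr2; nra.
  have Ea : alpha_factor R s.+2 p - 1 =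
      (xr R s.+2 p + (-1) ^+ s.+2 / p%:R) / p%:R ^+ s.+3 - p%:R^-1.
    by rewrite alpha_factorB1 // -E -mulrBl; congr (_ / _); rewrite addrAC.
  have : 0 <= (xr R s.+2 p + (-1) ^+ s.+2 / p%:R) / p%:R ^+ s.+3.
    by rewrite divr_ge0 ?exprn_ge0 //; lra.
  lra.
rewrite -subr_le0 alpha_factorB1 // pmulr_lle0 ?invr_gt0 ?exprn_gt0 //.
have h1 : (p%:R - 1) ^+ s.+2 <= p%:R ^+ s.+2 - p%:R ^+ s.+1 :> R.
  rewrite [(_ - _) ^+ s.+2]exprS [p%:R ^+ s.+2]exprS -[X in _ <= _ - X]mul1r.
  rewrite -mulrBl ler_wpM2l ?lerXn2r ?nnegrE //; lra.
have h2 : p%:R <= p%:R ^+ s.+1 :> R.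
  by rewrite exprS ler_peMr ?(ltW p0) ?exprn_ege1 //; lra.
have h3 : (-1) ^+ s.+2 * (p%:R - 2) <= p%:R - 2 :> R by rewrite ler_piMl //; lra.
rewrite /xr; move: ((p%:R - 1) ^+ s.+2) (p%:R ^+ s.+2) (p%:R ^+ s.+1) h1 h2 => X Y Z.
move: ((-1) ^+ s.+2 / p%:R) dl du => c; move: ((-1) ^+ s.+2 * _) h3 => b; lra.
Qed.

(** Write a factor as $1-v$ with $0 \le v \le 1/2$; then $1-v \ge \exp(-2v)$. Rankin's prime bound
    at $e=1$ gives $v \le (s+4)p^{-2}$, and the last [2] bounds $\sum_p p^{-2}$. *)
Lemma alpha_partial_ge N : expR (- (2 * s.+4%:R * 2)) <= alpha_partial R s.+2 N.
Proof.
apply: (@le_trans _ _ (\prod_(p < N | prime p)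
    expR (- (2 * s.+4%:R) * p%:R `^ (- 1 - 1)))).
  rewrite -expR_sum ler_expR -mulr_sumr mulNr lerN2 ler_wpM2l //.
  by have := @sum_prime_powRN_le R 1 ltr01 N; rewrite invr1.
apply: ler_prod => p pp; rewrite expR_ge0 /=.
have /andP[a2 a1] := alpha_factor_itv pp.
set a := alpha_factor _ _ _ in a1 a2 *.
have v_le : 1 - a <= s.+4%:R * p%:R `^ (- 1 - 1).
  apply: le_trans (rankin_term_prime_le s ltr01 pp).
  have n1 (d : nat) : (0 < d)%N -> rankin_term s 1 d = `|F d|.
    by move=> d0; rewrite (norm_gr_quot_div 1) // subrr powRr0 mulr1.
  rewrite !n1 ?expn_gt0 ?(prime_gt0 pp) // /a alpha_factorE //.
  have := ler_norm (- F p); have := ler_norm (- F (p ^ 2)%N); rewrite !normrN /=; lra.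
apply: (@le_trans _ _ (expR (- (2 * (1 - a))))).
  by rewrite ler_expR mulNr lerN2 -mulrA ler_pM2l.
(* The chain is $\exp(-2v) \le 1/(1+2v) \le 1-v$; its last step amounts to $v(1-2v) \ge 0$. *)
rewrite expRN; have h := expR_ge1Dx (2 * (1 - a)).
have h0 : 0 < 1 + 2 * (1 - a) by lra.
apply: (@le_trans _ _ (1 + 2 * (1 - a))^-1).
  by rewrite lef_pV2 ?posrE ?expR_gt0.
by rewrite -[leLHS]mul1r ler_pdivrMr //; nra.
Qed.

Lemma alpha_partial_noninc : nonincreasing_seq (alpha_partial R s.+2).
Proof.
apply/nonincreasing_seqP => N; rewrite /alpha_partial [leLHS]big_mkcond big_ord_recr /=.
rewrite -big_mkcond /=; case: ifP => pN; last by rewrite mulr1.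
have /andP[_ a1] := alpha_factor_itv pN.
by rewrite ler_piMr // (le_trans (expR_ge0 _) (alpha_partial_ge N)).
Qed.

Lemma is_cvg_alpha_partial : cvgn (alpha_partial R s.+2).
Proof.
apply: nonincreasing_is_cvgn; first exact: alpha_partial_noninc.
by exists (expR (- (2 * s.+4%:R * 2))) => _ [N _ <-]; apply: alpha_partial_ge.
Qed.

Lemma alpha_gt0 : 0 < alpha R s.+2.
Proof.
apply: (lt_le_trans (expR_gt0 (- (2 * s.+4%:R * 2)))).
apply: limr_ge; first exact: is_cvg_alpha_partial.
by apply: nearW => N; apply: alpha_partial_ge.
Qed.

(** The expanded product contains every nonzero term with $d \le N$. What remains has $d \ge N+1 \ge
    y$, so $d^{e-1} \le y^{e-1}$, and Rankin's bound applies uniformly in $M$. *)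
Lemma alpha_partial_tail (e y : R) N M : 0 < e < 1 -> 0 < y <= N.+1%:R -> (N < M)%N ->
  `|alpha_partial R s.+2 M - \sum_(1 <= d < N.+1) F d| <= y `^ (e - 1) * rankin_bound s e.
Proof.
move=> /andP[e0 e1] /andP[y0 yN] NM; rewrite alpha_partialE.
set D := prime_sq_prod M; have D0 : (0 < D)%N := prime_sq_prod_gt0 M.
have -> : \sum_(1 <= d < N.+1) F d = \sum_(d <- divisors D | (d <= N)%N) F d.
  rewrite (bigID (fun d => d \in divisors D)) /= [X in _ + X]big_nat_cond.
  rewrite [X in _ + X]big1 ?addr0; last first.
    move=> d /andP[/andP[d0 dN]]; rewrite -dvdn_divisors // => dP.
    have [fd|fd] := eqVneq (f d) 0; first by rewrite fd mul0r.
    move: dP; rewrite dvdn_prime_sq_prod ?d0 ?(leq_trans dN) //; exact: gr_quot_cube_free fd.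
  rewrite -big_filter -[in RHS]big_filter; apply: perm_big; apply: uniq_perm.
  - by rewrite filter_uniq ?iota_uniq.
  - by rewrite filter_uniq ?divisors_uniq.
  move=> d; rewrite !mem_filter mem_index_iota andbC.
  case: (boolP (d \in divisors D)); rewrite ?andbF ?andbT // -dvdn_divisors // => dD.
  by rewrite (dvdn_gt0 D0 dD).
rewrite (bigID (fun d => d <= N)%N) /= addrAC subrr add0r.
apply: le_trans (ler_norm_sum _ _ _) _.
apply: (@le_trans _ _ (\sum_(d <- divisors D) y `^ (e - 1) * rankin_term s e d)); last first.
  by rewrite -mulr_sumr ler_wpM2l ?powR_ge0 // sum_rankin_term_le.
rewrite big_mkcond big_seq [leRHS]big_seq; apply: ler_sum => d.
rewrite -dvdn_divisors // => /(dvdn_gt0 D0) d0.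
case: ifP => [|_]; last by rewrite mulr_ge0 ?powR_ge0 ?rankin_term_ge0.
rewrite -ltnNge => Nd; rewrite (norm_gr_quot_div e) // mulrC ler_wpM2r ?rankin_term_ge0 //.
rewrite -[e - 1]opprB !powRN lef_pV2 ?posrE ?powR_gt0 ?ltr0n //.
apply: ge0_ler_powR; rewrite ?nnegrE ?(ltW y0) //; first lra.
by apply: le_trans yN _; rewrite ler_nat.
Qed.

Lemma alpha_tail (e y : R) N : 0 < e < 1 -> 0 < y <= N.+1%:R ->
  `|alpha R s.+2 - \sum_(1 <= d < N.+1) F d| <= y `^ (e - 1) * rankin_bound s e.
Proof.
move=> e01 yN; rewrite ler_norml lerBrDr lerBlDr; apply/andP; split.
  apply: limr_ge; first exact: is_cvg_alpha_partial.
  exists N.+1 => // M /= NM; rewrite -lerBrDr.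
  by have := alpha_partial_tail e01 yN NM; rewrite ler_norml => /andP[].
apply: limr_le; first exact: is_cvg_alpha_partial.
exists N.+1 => // M /= NM; rewrite -lerBlDr.
by have := alpha_partial_tail e01 yN NM; rewrite ler_norml => /andP[].
Qed.

Lemma sum_gr_real_approx (e x : R) : 0 < e < 1 -> 1 <= x ->
  `|\sum_(1 <= m < (Num.truncn x).+1) gr_real R s m - alpha R s.+2 / s.+2%:R * x ^+ s.+2|
  <= 2 * rankin_bound s e * x `^ (s.+1%:R + e).
Proof.
move=> e01 x1; have x0 : 0 < x := lt_le_trans ltr01 x1.
have /andP[e0 e1] := e01; set N := Num.truncn x.
have /andP[Nx xN] : N%:R <= x < N.+1%:R by apply: truncn_itv; apply: ltW.
rewrite sum_gr_real; set A := \sum_(_ <= d < _) _.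
pose B := \sum_(1 <= d < N.+1) F d.
(* Two errors of equal size, whence the [2]: replacing each inner power sum by its main term, and
   completing the truncated series [B] to [alpha]. *)
have -> : A - alpha R s.+2 / s.+2%:R * x ^+ s.+2 =
  (A - x ^+ s.+2 / s.+2%:R * B) - x ^+ s.+2 / s.+2%:R * (alpha R s.+2 - B) by ring.
apply: le_trans (ler_normB _ _) _.
have -> : 2 * rankin_bound s e * x `^ (s.+1%:R + e) =
  x `^ (s.+1%:R + e) * rankin_bound s e + x `^ (s.+1%:R + e) * rankin_bound s e by ring.
apply: lerD.
  rewrite /B mulr_sumr /A -sumrB.
  apply: le_trans (ler_norm_sum _ _ _) _.
  apply: (@le_trans _ _ (\sum_(1 <= d < N.+1) x `^ (s.+1%:R + e) * rankin_term s e d)).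
    rewrite big_nat [leRHS]big_nat; apply: ler_sum => d /andP[d1 dN].
    have d0 : 0 < d%:R :> R by rewrite ltr0n.
    have dx : d%:R <= x by apply: le_trans Nx; rewrite ler_nat.
    have -> : x ^+ s.+2 / s.+2%:R * (f d / d%:R ^+ s.+2) =
        f d * ((x / d%:R) ^+ s.+2 / s.+2%:R) by rewrite expr_div_n; ring.
    rewrite -mulrBr normrM /rankin_term mulrCA ler_wpM2l //.
    (* [N %/ d] is the floor of [x / d], as the power sum estimate requires. *)
    have Nd : (N %/ d)%:R <= x / d%:R < (N %/ d).+1%:R.
      rewrite ler_pdivlMr // ltr_pdivrMr // -!natrM; apply/andP; split.
        by apply: le_trans Nx; rewrite ler_nat leq_trunc_div.
      by apply: lt_le_trans xN _; rewrite ler_nat ltn_ceil.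
    apply: le_trans (sum_expr_approx _ Nd) _.
    rewrite -powR_mulrn ?divr_ge0 ?(ltW x0) //.
    (* Since [x / d] is at least [1], the exponent may be raised by [e]; this produces the Rankin
       weight. *)
    apply: (@le_trans _ _ ((x / d%:R) `^ (s.+1%:R + e))).
      by apply: ler_powR; rewrite ?ler_pdivlMr ?mul1r // lerDl ltW.
    rewrite powRN ler_pdivlMr ?powR_gt0 // -powRM ?divr_ge0 ?(ltW x0) //.
    by rewrite divfK ?gt_eqF.
  rewrite -mulr_sumr ler_wpM2l ?powR_ge0 //; exact: sum_rankin_term_nat_le.
have -> : x `^ (s.+1%:R + e) = x ^+ s.+2 * x `^ (e - 1).
  rewrite -powR_mulrn ?(ltW x0) // -powRD ?(gt_eqF x0) ?implybT //.
  by congr (_ `^ _); rewrite -[s.+2%:R]natr1; ring.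
rewrite normrM -mulrA; apply: ler_pM => //; last first.
  by apply: alpha_tail; rewrite // x0 ltW.
rewrite ger0_norm ?divr_ge0 ?exprn_ge0 ?(ltW x0) //.
by rewrite ler_piMr ?exprn_ge0 ?(ltW x0) // invf_le1 ?ler1n ?ltr0n.
Qed.

End Alpha.

(** * Asymptotics *)

Section Asymptotics.
Variables (R : realType) (s : nat).

Lemma norm_real_complex (x : R) : `|x%:C| = `|x|%:C.
Proof. by rewrite normc_def /= expr0n addr0 sqrtr_sqr. Qed.

Lemma sum_gr_realE N :
  \sum_(1 <= m < N.+1) gr R s.+2 m = (\sum_(1 <= m < N.+1) gr_real R s m)%:C.
Proof.
rewrite rmorph_sum /=; apply: eq_big_nat => m /andP[m0 _].
exact: gr_realE.
Qed.

(** Both sums are compared with $\alpha_r n^r/r$. Taking $e=1/2$ gives a total error $S n^{r-1/2}$,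
    of lower order because $\alpha_r > 0$. *)
Lemma sum_gr_real_equiv (eta : R) : 0 < eta -> \forall n \near \oo,
  `|\sum_(1 <= m < n.+1) gr_real R s m -
    \sum_(1 <= m < n.+1) alpha R s.+2 * m%:R ^+ s.+1| <=
  eta * `|\sum_(1 <= m < n.+1) alpha R s.+2 * m%:R ^+ s.+1|.
Proof.
move=> eta0; have a0 := alpha_gt0 R s; set a := alpha R s.+2 in a0 *.
have h01 : 0 < (2^-1 : R) < 1 by apply/andP; split; lra.
set S := 2 * rankin_bound s (2^-1 : R) + a.
have S0 : 0 < S by rewrite addr_gt0 // mulr_gt0 // expR_gt0.
have r0 : (0 : R) < s.+2%:R by rewrite ltr0n.
(* The threshold is chosen so that $\sqrt n \ge K$ is equivalent to $S n^{r-1/2} \le \eta\,\alpha_r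
   n^r/r$. *)
set K := S * s.+2%:R / (eta * a).
have K0 : 0 < K by rewrite divr_gt0 ?mulr_gt0.
exists (Num.truncn (K ^+ 2)).+1 => // n /= Kn.
have n1 : (1 <= n)%N by apply: leq_ltn_trans Kn.
have n0 : (0 : R) < n%:R by rewrite ltr0n.
have Kn2 : K <= n%:R `^ 2^-1.
  rewrite powR12_sqrt // -[K]ger0_norm ?(ltW K0) // -sqrtr_sqr ler_wsqrtr //.
  by apply: ltW; apply: lt_le_trans (truncnS_gt _) _; rewrite ler_nat.
rewrite -mulr_sumr; set G := \sum_(_ <= _ < _) _; set E := \sum_(_ <= _ < _) _.
have G_le : `|G - a / s.+2%:R * n%:R ^+ s.+2| <=
    2 * rankin_bound s (2^-1 : R) * n%:R `^ (s.+1%:R + 2^-1).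
  have := @sum_gr_real_approx R s 2^-1 n%:R h01; rewrite ler1n natrK; exact.
have E_le : `|E - n%:R ^+ s.+2 / s.+2%:R| <= n%:R ^+ s.+1.
  by apply: sum_expr_approx; rewrite lexx ltr_nat ltnSn.
have E_ge : n%:R ^+ s.+2 / s.+2%:R <= E := sum_expr_ge R s.+1 n.
have E0 : 0 <= E by apply: le_trans E_ge; rewrite divr_ge0 ?exprn_ge0.
have XE : n%:R `^ (s.+1%:R + 2^-1) = n%:R ^+ s.+1 * n%:R `^ 2^-1 :> R.
  by rewrite powRD ?(gt_eqF n0) ?implybT // powR_mulrn.
set X := _ `^ _ in G_le XE.
have nX : n%:R ^+ s.+1 <= X.
  by rewrite -powR_mulrn // ler_powR ?ler1n // lerDl.
have D_le : `|G - a * E| <= S * X.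
  have -> : G - a * E = (G - a / s.+2%:R * n%:R ^+ s.+2) - a * (E - n%:R ^+ s.+2 / s.+2%:R).
    by ring.
  apply: le_trans (ler_normB _ _) _; rewrite [S * X]mulrDl; apply: lerD => //.
  rewrite normrM gtr0_norm // ler_pM2l //; exact: le_trans E_le nX.
apply: le_trans D_le _; rewrite ger0_norm ?mulr_ge0 ?(ltW a0) // mulrA.
apply: (@le_trans _ _ (eta * a * (n%:R ^+ s.+2 / s.+2%:R))); last first.
  by rewrite ler_pM2l ?mulr_gt0.
have n2 : n%:R = n%:R `^ 2^-1 * n%:R `^ 2^-1 :> R.
  rewrite -powRD ?(gt_eqF n0) ?implybT //.
  have -> : 2^-1 + 2^-1 = 1 :> R by lra.
  by rewrite powRr1.
have : S * s.+2%:R <= eta * a * n%:R `^ 2^-1.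
  by move: Kn2; rewrite ler_pdivrMr ?mulr_gt0 // [leRHS]mulrC.
move=> h; rewrite XE [leRHS]mulrA ler_pdivlMr //.
have -> : n%:R ^+ s.+2 = n%:R ^+ s.+1 * (n%:R `^ 2^-1 * n%:R `^ 2^-1) :> R.
  by rewrite exprSr -n2.
have W0 : 0 <= n%:R ^+ s.+1 * n%:R `^ 2^-1 :> R by rewrite mulr_ge0 ?exprn_ge0 ?powR_ge0.
have := ler_wpM2r W0 h; move: (n%:R ^+ s.+1) (n%:R `^ 2^-1) => u v; lra.
Qed.

End Asymptotics.

Theorem theorem4 (R : realType) (r : nat) (hr2 : (2 <= r)%N) :
  [/\ cvgn (@alpha_partial R r),
      average_order (@gr R r) (fun m => (alpha R r * m%:R ^+ (r - 1))%:C)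
    & forall eps : R, 0 < eps < 1 ->
        (fun x : R => summatory (@gr R r) x : Cfield R)
        = (fun x : R => (alpha R r / r%:R * x ^+ r)%:C : Cfield R)
        +O_ (pinfty_nbhs R) (fun x : R => (x `^ (r%:R - 1 + eps))%:C : Cfield R)].
Proof.
case: r hr2 => [|[|s]] // _; split.
- exact: is_cvg_alpha_partial.
- apply/eqaddoP => eps eps0.
  (* The tolerance is an element of [R[i]]; its positivity forces it to be real. *)
  have [eta epsE eta0] : exists2 eta : R, eps = eta%:C & 0 < eta.
    move: eps0; rewrite ltcE /= => /andP[/eqP Ie Re0]; exists (complex.Re eps) => //.
    by case: (eps) Ie => a b /= ->.
  have := sum_gr_real_equiv s eta0; apply: filterS => n h.
  rewrite !fctE subn1 /=.
  have -> : \sum_(1 <= m < n.+1) (alpha R s.+2 * m%:R ^+ s.+1)%:C =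
    (\sum_(1 <= m < n.+1) alpha R s.+2 * m%:R ^+ s.+1)%:C :> Cfield R by rewrite rmorph_sum.
  rewrite sum_gr_realE -rmorphB epsE !norm_real_complex -rmorphM lecR; exact: h.
move=> eps eps01; have -> : s.+2%:R - 1 + eps = s.+1%:R + eps by rewrite -natr1 addrK.
apply/eqaddOP/bigO_exP.
exists ((2 * rankin_bound s eps)%:C).
  by rewrite ltcR mulr_gt0 // expR_gt0.
exists 1; split=> // x x1; have := @sum_gr_real_approx R s eps x eps01 (ltW x1).
move=> h; rewrite !fctE /summatory sum_gr_realE -rmorphB.
rewrite !norm_real_complex -rmorphM lecR [`|_ `^ _|]ger0_norm ?powR_ge0 //.
Qed.
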